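(* Let $k \ge 1$ be an integer, and let $P(k,k)$ denote the probability that the two-player M\&M Game, played with fair coins and with both players starting with $k$ M\&M's, ends in a tie. Then $$P(k,k) \;=\; \sum_{n=k}^\infty \binom{n-1}{k-1} \left(\frac12\right)^n \binom{n-1}{k-1} \left(\frac12\right)^n \;=\; \sum_{n=k}^\infty \binom{n-1}{k-1}^2 \frac{1}{2^{2n}}.$$
   Context: The two-player M\&M Game: each of two players starts with a given number of M\&M's (here both start with $k$). In each round $n=1,2,3,\dots$ both players simultaneously toss a fair coin; all tosses (of both players and over all rounds) are independent, each being heads with probability $1/2$. A player who tosses a head eats one of their M\&M's (if they have any left); a player who tosses a tail does not eat. Play continues until no one has any M\&M's left. The game ends in a tie if both players eat their last M\&M in the same round, i.e. if the round in which the first player tosses their $k$-th head equals the round in which the second player tosses their $k$-th head. $\binom{n}{r} = \frac{n!}{r!(n-r)!}$ is the binomial coefficient. *)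

(* Defs.v *)
From HB Require Import structures.
From mathcomp Require Import all_boot all_order all_algebra.
From mathcomp Require Import all_classical all_reals all_analysis.

Set Implicit Arguments.
Unset Strict Implicit.
Unset Printing Implicit Defensive.
Import Order.TTheory GRing.Theory Num.Theory.
Local Open Scope classical_set_scope.
Local Open Scope ring_scope.

(* Mutual independence of an arbitrary family of random variables: the product
   rule holds for every finite subfamily, listed without repetition by [J]. *)
Definition mutually_independent {d d'} {T : measurableType d}
    {T' : measurableType d'} {R : realType} (P : probability T R)
    (I : eqType) (X : I -> {RV P >-> T'}) : Prop :=
  forall (J : seq I) (B : I -> set T'), uniq J ->
    (forall i, measurable (B i)) ->
    P (\bigcap_(i in [set` J]) (X i @^-1` B i)) =
      (\big[*%E/1%E]_(i <- J) P (X i @^-1` B i))%E.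

(* The players are ['I_2]. Rounds are numbered from 1: [toss i n] is the toss
   of player [i] in round [n.+1], with [true] standing for heads. *)
Record independent_fair_tosses {d} {T : measurableType d} {R : realType}
    (P : probability T R) (toss : 'I_2 -> nat -> {RV P >-> bool}) : Prop := {
  tosses_fair : forall i n, P (toss i n @^-1` [set true]) = (1 / 2)%:E ;
  tosses_independent :
    mutually_independent (fun p : 'I_2 * nat => toss p.1 p.2) }.

(* The number of M&M's left after [n] rounds to a player who starts with [k] of
   them and whose successive tosses are [s]. *)
Fixpoint left_after (k : nat) (s : nat -> bool) (n : nat) : nat :=
  if n is m.+1 then
    if s m then (left_after k s m).-1 else left_after k s m
  else k.

(* False for [n = 0], since then [n.-1 = n]. *)
Definition eats_last_in_round (k : nat) (s : nat -> bool) (n : nat) : bool :=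
  (0 < left_after k s n.-1)%N && (left_after k s n == 0)%N.

Definition tie {d} {T : measurableType d} {R : realType}
    {P : probability T R} (toss : 'I_2 -> nat -> {RV P >-> bool})
    (k : nat) : set T :=
  [set w | exists n : nat,
     forall i : 'I_2, eats_last_in_round k (fun m => toss i m w) n].

(* Main.v *)
(* The tie events of distinct rounds are disjoint. A tie in round [n.+1] means
   that both players toss heads in that round after exactly [k.-1] heads each in
   the first [n], so the event splits into ['C(n, k.-1) ^ 2] disjoint cylinders,
   each prescribing [2 * n.+1] independent fair tosses. *)
Require Import Defs.
From HB Require Import structures.
From mathcomp Require Import all_boot all_order all_algebra.
From mathcomp Require Import all_classical all_reals all_analysis.
From mathcomp Require Import zify ring.

Set Implicit Arguments.
Unset Strict Implicit.
Unset Printing Implicit Defensive.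
Import Order.TTheory GRing.Theory Num.Theory.
Local Open Scope classical_set_scope.
Local Open Scope ring_scope.

(** Truncated subtraction matches [.-1], which keeps a player without M&M's at 0. *)
Lemma left_afterE (k : nat) (s : nat -> bool) (n : nat) :
  left_after k s n = (k - \sum_(m < n) s m)%N.
Proof.
elim: n => [|n IHn] /=; first by rewrite big_ord0 subn0.
by rewrite big_ord_recr /= IHn; case: (s n); rewrite ?addn0 ?addn1 ?subnS.
Qed.

Lemma left_after_nonincreasing (k : nat) (s : nat -> bool) :
  {homo left_after k s : m n / (m <= n)%N >-> (n <= m)%N}.
Proof.
move=> m n /subnK <-; elim: (n - m)%N => //= p IHp.
by case: (s _) => //; apply: leq_trans (leq_pred _) IHp.
Qed.

(** A supply that has reached 0 stays there, so it cannot be positive just before a later round.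
    This makes ties in distinct rounds disjoint. *)
Lemma eats_last_in_round_inj (k : nat) (s : nat -> bool) (m n : nat) :
  eats_last_in_round k s m -> eats_last_in_round k s n -> m = n.
Proof.
wlog le_mn : m n / (m <= n)%N => [wlog_mn|].
  by case: (leqP m n) => [|/ltnW] le em en; [|apply/esym]; apply: wlog_mn.
move=> /andP[_ /eqP lm0] /andP[ln _]; apply/eqP; rewrite eqn_leq le_mn leqNgt.
apply/negP => lt_mn.
have /(left_after_nonincreasing k s) : (m <= n.-1)%N by lia.
by rewrite lm0 leqn0 => /eqP ln0; rewrite ln0 in ln.
Qed.

(** A tail leaves the supply unchanged, and a head brings it from positive to 0 only from 1.
    Recording the earlier heads as a finite set lets binomial coefficients count them. *)
Lemma eats_last_in_roundE (k : nat) (s : nat -> bool) (n : nat) : (0 < k)%N ->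
  eats_last_in_round k s n.+1 =
  s n && (#|[set m : 'I_n | s m]%SET| == k.-1).
Proof.
move=> k_gt0; rewrite /eats_last_in_round !left_afterE /= big_ord_recr /=.
have -> : (\sum_(m < n) s m = #|[set m : 'I_n | s m]%SET|)%N.
  by rewrite -sum1dep_card [RHS]big_mkcond; apply: eq_bigr => m _; case: (s m).
by case: (s n) => /=; lia.
Qed.

Lemma eats_last_in_round_geq (k : nat) (s : nat -> bool) (n : nat) :
  (0 < k)%N -> eats_last_in_round k s n -> (k <= n)%N.
Proof.
case: n => [|n] k_gt0; first by rewrite /eats_last_in_round /=; case: k k_gt0.
rewrite eats_last_in_roundE// => /andP[_ /eqP cardE].
have := max_card (mem [set m : 'I_n | s m]%SET).
by rewrite cardE card_ord; lia.
Qed.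

Section fair_cylinders.
Context {d : measure_display} {T : measurableType d} {R : realType}.
Variables (P : probability T R) (I : eqType) (X : I -> {RV P >-> bool}).
Hypothesis X_fair : forall i, P (X i @^-1` [set true]) = (1 / 2)%:E.
Hypothesis X_indep : mutually_independent X.

Lemma fair_preimage (i : I) (b : bool) : P (X i @^-1` [set b]) = (1 / 2)%:E.
Proof.
case: b => //; have -> : [set false] = ~` [set true] :> set bool.
  by apply/seteqP; split=> -[] //=.
rewrite -preimage_setC probability_setC ?X_fair; last first.
  exact: measurable_funPTI.
by rewrite -EFinB; congr EFin; field.
Qed.

Definition cylinder (J : seq I) (b : I -> bool) : set T :=
  \bigcap_(i in [set` J]) (X i @^-1` [set b i]).

Lemma measurable_cylinder (J : seq I) (b : I -> bool) :
  measurable (cylinder J b).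
Proof.
apply: fin_bigcap_measurable => [|i _]; first exact: finite_seq.
exact: measurable_funPTI.
Qed.

(** Independence gives a product over [J], in which every factor is 1/2 whichever side of the coin
    [b] prescribes. *)
Lemma cylinder_prob (J : seq I) (b : I -> bool) : uniq J ->
  P (cylinder J b) = ((1 / 2) ^+ size J)%:E.
Proof.
move=> uJ; rewrite X_indep//; elim: J {uJ} => [|i J IHJ]; first by rewrite big_nil.
by rewrite big_cons IHJ fair_preimage -EFinM exprS.
Qed.

End fair_cylinders.

Lemma tie_bigcup (d : measure_display) (T : measurableType d) (R : realType)
    (P : probability T R) (toss : 'I_2 -> nat -> {RV P >-> bool}) (k : nat) :
  (0 < k)%N ->
  tie toss k = \bigcup_(n in [set n | (k <= n)%N])
    [set w | forall i, eats_last_in_round k (fun m => toss i m w) n].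
Proof.
move=> k_gt0; apply/seteqP; split => w [n]; last by move=> _ en; exists n.
(* Either player alone forces [k <= n]: eating [k] M&M's takes at least [k] rounds. *)
by move=> en; exists n => //=; exact: (eats_last_in_round_geq k_gt0 (en ord0)).
Qed.

Section tie_in_round.
Context {d : measure_display} {T : measurableType d} {R : realType}.
Variables (P : probability T R) (toss : 'I_2 -> nat -> {RV P >-> bool}).
Hypothesis htoss : independent_fair_tosses toss.
Variables (k : nat) (k_gt0 : (0 < k)%N).

Let tie_in_round (n : nat) : set T :=
  [set w | forall i, eats_last_in_round k (fun m => toss i m w) n].

Let first_tosses (n : nat) : seq ('I_2 * nat) :=
  [seq (i, m) | i <- enum 'I_2, m <- iota 0 n.+1].

(* [F i] is the set of the first [n] rounds in which player [i] gets heads;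
   in the next round both players get heads. *)
Let outcome (n : nat) (F : {ffun 'I_2 -> {set 'I_n}}) (p : 'I_2 * nat) : bool :=
  oapp (fun m : 'I_n => m \in F p.1) true (insub p.2).

Let tie_outcomes (n : nat) : seq {ffun 'I_2 -> {set 'I_n}} :=
  enum (ffun_on [set A : {set 'I_n} | #|A| == k.-1]%SET).

Let tie_cylinder (n : nat) (F : {ffun 'I_2 -> {set 'I_n}}) : set T :=
  cylinder (fun p => toss p.1 p.2) (first_tosses n) (outcome F).

Let size_tie_outcomes (n : nat) : size (tie_outcomes n) = ('C(n, k.-1) ^ 2)%N.
Proof. by rewrite -cardE card_ffun_on card_draws !card_ord. Qed.

(** Indices in [first_tosses n] are at most [n], so there [insub] fails only at [n], where the
    default [true] of [outcome] prescribes the final head. *)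
Let tie_cylinderP (n : nat) (F : {ffun 'I_2 -> {set 'I_n}}) (w : T) :
  tie_cylinder F w <->
  (forall i, toss i n w) /\ (forall i (m : 'I_n), toss i m w = (m \in F i)).
Proof.
split=> [cw|[tn tF] p /allpairsP[[i m] [_ + ->]]].
  have cwi i m : (m < n.+1)%N -> toss i m w = outcome F (i, m).
    move=> mn; apply: (cw (i, m)); apply/allpairsP; exists (i, m).
    by rewrite mem_enum mem_iota.
  split=> i; first by rewrite cwi// /outcome insubN// ltnn.
  by move=> m; rewrite cwi ?/outcome ?valK// ltnW// ltnS.
rewrite mem_iota add0n ltnS /outcome /=; case: insubP => [m0 _ <- _|].
  by rewrite tF.
rewrite -leqNgt => nm mn; have -> /= : m = n by apply: anti_leq; rewrite mn nm.
exact: tn.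
Qed.

Let tie_in_roundS (n : nat) :
  tie_in_round n.+1 = \bigcup_(F in [set` tie_outcomes n]) tie_cylinder F.
Proof.
apply/seteqP; split => w.
  (* The witness is read off from [w]: the rounds before the tie in which each player tosses
     heads. *)
  move=> tw; exists [ffun i => [set m : 'I_n | toss i m w]%SET] => /=.
    rewrite mem_enum; apply/ffun_onP => i; rewrite ffunE inE.
    by have := tw i; rewrite eats_last_in_roundE// => /andP[].
  apply/tie_cylinderP; split=> i.
    by have := tw i; rewrite eats_last_in_roundE// => /andP[].
  by move=> m; rewrite ffunE inE.
move=> [F /= + /tie_cylinderP[tn tF]] i; rewrite mem_enum => /ffun_onP/(_ i).
rewrite inE eats_last_in_roundE// tn => /eqP <- /=; apply/eqP/eq_card => m.
by rewrite inE tF.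
Qed.

Let measurable_tie_cylinder (n : nat) (F : {ffun 'I_2 -> {set 'I_n}}) :
  measurable (tie_cylinder F).
Proof. exact: measurable_cylinder. Qed.

(** Any point of a cylinder determines its [F], since membership in [F i] is the result of a toss at
    that point. *)
Let trivIset_tie_cylinder (n : nat) :
  trivIset [set` tie_outcomes n] (@tie_cylinder n).
Proof.
move=> F G _ _ [w [/tie_cylinderP[_ tF] /tie_cylinderP[_ tG]]].
by apply/ffunP => i; apply/setP => m; rewrite -tF tG.
Qed.

Let prob_tie_cylinder (n : nat) (F : {ffun 'I_2 -> {set 'I_n}}) :
  P (tie_cylinder F) = ((1 / 2) ^+ (2 * n.+1))%:E.
Proof.
rewrite cylinder_prob.
- by rewrite size_allpairs size_enum_ord size_iota.
- by move=> p; exact: tosses_fair htoss _ _.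
- exact: tosses_independent htoss.
- by apply: allpairs_uniq; rewrite ?enum_uniq ?iota_uniq// => -[? ?] [? ?].
Qed.

Lemma measurable_tie_in_round (n : nat) : measurable (tie_in_round n).
Proof.
case: n => [|n]; last first.
  rewrite tie_in_roundS; apply: fin_bigcup_measurable => [|F _].
    exact: finite_seq.
  exact: measurable_tie_cylinder.
(* The decomposition into cylinders covers successors only; at 0 no tie can occur, because [k] is
   positive. *)
suff -> : tie_in_round 0 = set0 by [].
apply/seteqP; split=> // w /(_ ord0)/(eats_last_in_round_geq k_gt0).
by rewrite leqNgt k_gt0.
Qed.

(** Finite additivity over equiprobable cylinders: each player independently chooses [k.-1] of the
    first [n] rounds, whence the squared binomial. *)
Lemma prob_tie_in_roundS (n : nat) :
  P (tie_in_round n.+1) = ('C(n, k.-1)%:R ^+ 2 * (1 / 2) ^+ (2 * n.+1))%:E.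
Proof.
rewrite tie_in_roundS measure_fin_bigcup; first last.
- by move=> F _; exact: measurable_tie_cylinder.
- exact: trivIset_tie_cylinder.
- exact: finite_seq.
rewrite -fsbig_seq ?enum_uniq//.
rewrite (eq_bigr (fun=> ((1 / 2) ^+ (2 * n.+1))%:E)) => [|F _]; last first.
  exact: prob_tie_cylinder.
rewrite sumEFin big_const_seq count_predT size_tie_outcomes iter_addr_0.
by rewrite -natrX mulr_natl.
Qed.

Lemma prob_tie :
  P (tie toss k) =
  (\sum_(k <= n <oo) ('C(n.-1, k.-1)%:R ^+ 2 * (1 / 2) ^+ (2 * n))%:E)%E.
Proof.
rewrite tie_bigcup// measure_bigcup.
(* Countable additivity yields a series filtered by membership, so the lower bound [k] of the other
   series is turned into a filter too. *)
- rewrite [RHS]eseries_cond (@eq_eseriesl _ _ (leq k)) => [|n]; last first.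
    by rewrite mem_setE.
  apply: eq_eseriesr => -[|n] kn; last exact: prob_tie_in_roundS.
  by move: kn; rewrite /= leqNgt k_gt0.
- by move=> n _; exact: measurable_tie_in_round.
- move=> m n _ _ [w [/(_ ord0) em /(_ ord0) en]].
  exact: eats_last_in_round_inj em en.
Qed.

End tie_in_round.

Theorem theorem1p1 (R : realType) (d : measure_display)
    (T : measurableType d) (P : probability T R)
    (toss : 'I_2 -> nat -> {RV P >-> bool})
    (htoss : independent_fair_tosses toss)
    (k : nat) (hk : (1 <= k)%N) :
  (P (tie toss k) =
    \sum_(k <= n <oo) ('C(n.-1, k.-1)%:R * (1 / 2) ^+ n *
                       'C(n.-1, k.-1)%:R * (1 / 2) ^+ n)%:E)%E /\
  (\sum_(k <= n <oo) ('C(n.-1, k.-1)%:R * (1 / 2) ^+ n *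
                      'C(n.-1, k.-1)%:R * (1 / 2) ^+ n)%:E =
    \sum_(k <= n <oo) ('C(n.-1, k.-1)%:R ^+ 2 * (1 / 2 ^+ (2 * n)))%:E
    :> \bar R)%E.
Proof.
have pow2 n : (1 / 2) ^+ (2 * n) = (1 / 2) ^+ n * (1 / 2) ^+ n :> R.
  by rewrite mul2n -addnn exprD.
(* In the last series the power applies to the denominator alone. *)
have exp2inv n : (1 / 2) ^+ n = 1 / 2 ^+ n :> R by rewrite expr_div_n expr1n.
split; last first.
  apply: eq_eseriesr => n _; congr EFin.
  by rewrite -[in RHS]exp2inv pow2; ring.
rewrite prob_tie//; apply: eq_eseriesr => n _; congr EFin.
by rewrite pow2; ring.
Qed.
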